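(* Let $\mathbf{z}_i=(z_{i1},\dots,z_{ip})^{\rm T}\in\mathbb{R}^p$, $i=1,\dots,n$, let $\mathbf{x}_i=(1,\mathbf{z}_i^{\rm T})^{\rm T}$, and let $\sigma^2>0$. For any $\boldsymbol\delta=(\delta_1,\dots,\delta_n)\in\{0,1\}^n$ with $\sum_{i=1}^n\delta_i=k$ (representing subdata of size $k$), the matrix $\mathbf{M}(\boldsymbol\delta)=\frac{1}{\sigma^2}\sum_{i=1}^n\delta_i\mathbf{x}_i\mathbf{x}_i^{\rm T}$ satisfies $$|\mathbf{M}(\boldsymbol\delta)|\le\frac{k^{p+1}}{4^p\sigma^{2(p+1)}}\prod_{j=1}^p\big(z_{(n)j}-z_{(1)j}\big)^2,$$ where $z_{(n)j}=\max\{z_{1j},\dots,z_{nj}\}$ and $z_{(1)j}=\min\{z_{1j},\dots,z_{nj}\}$. Moreover, if the subdata (the covariate vectors $\mathbf{z}_i$ with $\delta_i=1$) consists of the $2^p$ points $(a_1,\dots,a_p)^{\rm T}$ with $a_j=z_{(n)j}$ or $a_j=z_{(1)j}$, $j=1,\dots,p$, each occurring equally often, then equality holds.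
   Context: $|\cdot|$ denotes the determinant of a matrix. $\mathbf{M}(\boldsymbol\delta)$ is the information matrix, based on the subdata indicated by $\boldsymbol\delta$, for the parameter of the linear model $y_i=\mathbf{x}_i^{\rm T}\boldsymbol\beta+\varepsilon_i$ with uncorrelated errors of variance $\sigma^2$. *)

(* Defs.v *)
From mathcomp Require Import all_boot all_order all_algebra.
From mathcomp Require Import reals.

Set Implicit Arguments.
Unset Strict Implicit.
Unset Printing Implicit Defensive.

Import Order.TTheory GRing.Theory Num.Theory.
Local Open Scope ring_scope.

Section InformationMatrix.
Variables (R : realType) (n p : nat).

(* There are n.+1 data points, so that the maximum and minimum of each
   covariate are taken over a nonempty family. *)
Implicit Types (z : 'I_n.+1 -> 'cV[R]_p) (delta : 'I_n.+1 -> bool).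

Definition regressor z (i : 'I_n.+1) : 'cV[R]_(1 + p) := col_mx 1%:M (z i).

Definition info_mx (sigma : R) z delta : 'M[R]_(1 + p) :=
  (sigma ^+ 2)^-1 *:
    \sum_i (delta i)%:R *: (regressor z i *m (regressor z i)^T).

(* The default value of the iterated max and min is itself one of the data
   values, hence it does not affect the result. *)
Definition zmax z (j : 'I_p) : R := \big[Num.max/z ord0 j 0]_i z i j 0.

Definition zmin z (j : 'I_p) : R := \big[Num.min/z ord0 j 0]_i z i j 0.

Definition is_corner z (a : 'cV[R]_p) : Prop :=
  forall j, a j 0 = zmax z j \/ a j 0 = zmin z j.

Definition subdata_count z delta (a : 'cV[R]_p) : nat :=
  #|[set i | delta i && (z i == a)]|.

(* The corners are counted as points: if some covariate is constant, there are
   fewer than 2 ^ p of them. *)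
Definition balanced_on_corners z delta : Prop :=
  (forall i, delta i -> is_corner z (z i)) /\
  (forall a b, is_corner z a -> is_corner z b ->
     subdata_count z delta a = subdata_count z delta b).

End InformationMatrix.

(* Main.v *)
Require Import Defs.
From mathcomp Require Import all_boot all_order all_algebra.
From mathcomp Require Import reals.
From mathcomp Require Import ring lra.

Set Implicit Arguments.
Unset Strict Implicit.
Unset Printing Implicit Defensive.

Import Order.TTheory GRing.Theory Num.Theory.
Local Open Scope ring_scope.

(** Centering each covariate at its midrange is a unitriangular change of
    regressors, so it preserves the determinant, and it makes the [j]-th centered
    covariate at most half the range in absolute value. Hadamard's inequality
    (the determinant of a positive semidefinite matrix is at most the product of
    its diagonal entries) then gives the bound. For subdata balanced on the
    corners, reflecting one coordinate about its midrange kills the off-diagonal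
    entries, and each diagonal entry attains its bound. *)

(** * Positive semidefinite matrices and Hadamard's inequality *)

Section Hadamard.
Variable R : realFieldType.

Definition psd n (A : 'M[R]_n) :=
  A^T = A /\ forall v : 'cV[R]_n, 0 <= (v^T *m A *m v) 0 0.

Lemma psd_gram (I : finType) n (c : I -> R) (y : I -> 'cV[R]_n) :
  (forall i, 0 <= c i) -> psd (\sum_i c i *: (y i *m (y i)^T)).
Proof.
move=> c_ge0; split=> [|v].
  rewrite raddf_sum; apply: eq_bigr => i _ /=.
  by rewrite linearZ /= trmx_mul trmxK.
rewrite mulmx_sumr mulmx_suml summxE; apply: sumr_ge0 => i _.
rewrite -scalemxAr -scalemxAl mxE mulr_ge0 //.
have -> : v^T *m (y i *m (y i)^T) *m v = (v^T *m y i) *m (v^T *m y i)^T.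
  by rewrite trmx_mul trmxK !mulmxA.
by rewrite mxE big_ord1 [X in _ * X]mxE -expr2 sqr_ge0.
Qed.

Lemma psd_congr n (T A : 'M[R]_n) : psd A -> psd (T *m A *m T^T).
Proof.
move=> [A_sym A_ge0]; split; first by rewrite !trmx_mul trmxK A_sym mulmxA.
move=> v; have := A_ge0 (T^T *m v).
by rewrite trmx_mul trmxK !mulmxA.
Qed.

Lemma psd_ul m n (A : 'M[R]_m) (B : 'M[R]_(m, n)) D C :
  psd (block_mx A B D C) -> psd A.
Proof.
move=> [sym pos]; split.
  by move: sym; rewrite tr_block_mx => /eq_block_mx[].
move=> v; have := pos (col_mx v 0).
rewrite tr_col_mx mul_row_block mul_row_col trmx0 !mul0mx !mulmx0.
by rewrite !addr0.
Qed.

Lemma psd_dr m n (A : 'M[R]_m) B D (C : 'M[R]_n) :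
  psd (block_mx A B D C) -> psd C.
Proof.
move=> [sym pos]; split.
  by move: sym; rewrite tr_block_mx => /eq_block_mx[].
move=> v; have := pos (col_mx 0 v).
rewrite tr_col_mx mul_row_block mul_row_col trmx0 !mul0mx !mulmx0.
by rewrite !add0r.
Qed.

Lemma psd_diag_ge0 n (A : 'M[R]_n) i : psd A -> 0 <= A i i.
Proof.
move=> [_ /(_ (delta_mx i 0))].
by rewrite trmx_delta -rowE -colE !mxE.
Qed.

(** With a zero pivot the quadratic form is affine in the first coordinate, so it can stay
    nonnegative only if its slope vanishes. *)
Lemma psd_row0 n (b : 'cV[R]_n) (C : 'M[R]_n) :
  psd (block_mx 0%:M b^T b C) -> b = 0.
Proof.
move=> [_ pos]; apply/colP => j; rewrite [RHS]mxE; apply/eqP/negPn/negP => bj.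
(* This [t] solves [2 * t * b j 0 + C j j = -1], the value of the form at the test vector below. *)
pose t : R := - (C j j + 1) / (2 * b j 0).
have := pos (col_mx t%:M (delta_mx j 0)).
rewrite tr_col_mx mul_row_block mul_row_col tr_scalar_mx trmx_delta.
rewrite -!scalar_mxM mulr0 raddf0 add0r mulmxDl mul_scalar_mx mul_mx_scalar.
rewrite -!rowE -scalemxAl -!colE !mxE.
have -> : t * b j 0 + (t * b j 0 + C j j) = -1.
  by rewrite /t; field; rewrite bj.
by rewrite lerNr oppr0 ler10.
Qed.

Lemma det_lunitri_congr m n (D : 'M[R]_(n, m)) (A : 'M[R]_(m + n)) :
  let T := block_mx 1%:M 0 D 1%:M in \det (T *m A *m T^T) = \det A.
Proof.
by move=> T; rewrite !det_mulmx det_tr det_lblock !det1 !mul1r mulr1.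
Qed.

(** Induction through the Schur complement [S] of the first entry [a]: [\det A] is [a * \det S], and
    passing from [C] to [S] only lowers the diagonal. *)
Lemma hadamard_psd n (A : 'M[R]_n) : psd A -> \det A <= \prod_i A i i.
Proof.
elim: n A => [|n IHn] A A_psd; first by rewrite det_mx00 big_ord0.
move: A A_psd; rewrite -[n.+1]/(1 + n)%N => A A_psd.
have [a [b [C defA]]] : exists a b C, A = block_mx (a%:M : 'M_1) b^T b C.
  exists (A 0 0), (dlsubmx A), (drsubmx A).
  have [A_sym _] := A_psd.
  rewrite -[LHS]submxK trmx_dlsub A_sym [ulsubmx A]mx11_scalar !mxE.
  by congr (block_mx (A _ _)%:M _ _ _); apply: val_inj.
rewrite {}defA in A_psd *.
have a_ge0 : 0 <= a.
  by have := psd_diag_ge0 0 (psd_ul A_psd); rewrite mxE.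
have prodE : \prod_i block_mx a%:M b^T b C i i = a * \prod_i C i i.
  rewrite big_split_ord /= big_ord1 block_mxEul mxE eqxx; congr (_ * _).
  by apply: eq_bigr => i _; rewrite block_mxEdr.
(* A zero pivot has no Schur complement, but then the first row vanishes and both sides are 0. *)
rewrite prodE; have [a0|a_neq0] := eqVneq a 0.
  rewrite a0 in A_psd *; rewrite (psd_row0 A_psd) mul0r.
  by rewrite trmx0 det_lblock det_scalar1 mul0r.
pose S := C - a^-1 *: (b *m b^T).
pose T : 'M_(1 + n) := block_mx 1%:M 0 (- a^-1 *: b) 1%:M.
have TAT : T *m block_mx a%:M b^T b C *m T^T = block_mx a%:M 0 0 S.
  rewrite /T tr_block_mx !mulmx_block !trmx1 !trmx0 !linearZ /=.
  have aD : a *: (- a^-1 *: b) = - b.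
    by rewrite scaleNr scalerN scalerA divff // scale1r.
  rewrite !mul1mx !mulmx1 !mul0mx !mulmx0 !addr0 !mul_mx_scalar -!scalemxAl.
  rewrite aD addNr mul0mx scaler0 add0r mul_scalar_mx scalerA.
  rewrite mulNr mulVf // scaleN1r addNr.
  by rewrite /S scaleNr addrC.
have S_psd : psd S.
  by have := psd_congr T A_psd; rewrite TAT; apply: psd_dr.
rewrite -(det_lunitri_congr (- a^-1 *: b)) TAT det_lblock det_scalar1.
apply: ler_wpM2l => //; apply: le_trans (IHn S S_psd) _.
(* The diagonal of [S] is nonnegative, and falls short of that of [C] by the squares of the entries
   of [b] over [a]. *)
apply: ler_prod => i _; rewrite psd_diag_ge0 //=.
rewrite /S !mxE big_ord1 mxE gerBl.
by rewrite mulr_ge0 ?invr_ge0 // -expr2 sqr_ge0.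
Qed.

End Hadamard.

(** * Centering at the midranges and the upper bound *)

Section CenteredInformation.
Variables (R : realType) (n p : nat) (z : 'I_n.+1 -> 'cV[R]_p).
Variable delta : 'I_n.+1 -> bool.

Definition midrange (j : 'I_p) : R := (zmax z j + zmin z j) / 2.

Definition half_range (j : 'I_p) : R := (zmax z j - zmin z j) / 2.

Definition centered (j : 'I_p) (a : 'cV[R]_p) : R := a j 0 - midrange j.

Definition centered_gram : 'M[R]_(1 + p) :=
  let y i := col_mx 1%:M (\col_j centered j (z i)) : 'cV[R]_(1 + p) in
  \sum_i (delta i)%:R *: (y i *m (y i)^T).

Lemma det_info_mx sigma :
  \det (info_mx sigma z delta) =
    (sigma ^+ 2)^-1 ^+ (1 + p) * \det centered_gram.
Proof.
rewrite /info_mx detZ; congr (_ * _).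
(* The leading 1 of each regressor lets a unitriangular matrix subtract the midranges from the
   covariates. *)
rewrite -(det_lunitri_congr (- \col_j midrange j)); congr (\det _).
rewrite mulmx_sumr mulmx_suml; apply: eq_bigr => i _.
rewrite -scalemxAr -scalemxAl; congr (_ *: _).
set T := block_mx _ _ _ _.
have -> : col_mx 1%:M (\col_j centered j (z i)) = T *m regressor z i.
  rewrite /T /regressor mul_block_col !mul1mx mul0mx addr0 mulmx1.
  by congr col_mx; apply/colP => j; rewrite !mxE addrC.
by rewrite trmx_mul !mulmxA.
Qed.

Let size_delta := \sum_i (delta i)%:R : R.

Lemma centered_gram_ul : centered_gram (lshift p 0) (lshift p 0) = size_delta.
Proof.
rewrite summxE; apply: eq_bigr => i _.
by rewrite mxE mxE big_ord1 [X in _ * (_ * X)]mxE !col_mxEu !mxE !mulr1.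
Qed.

Lemma centered_gram_dl j :
  centered_gram (rshift 1 j) (lshift p 0) =
    \sum_i (delta i)%:R * centered j (z i).
Proof.
rewrite summxE; apply: eq_bigr => i _.
by rewrite mxE mxE big_ord1 [X in _ * (_ * X)]mxE col_mxEu col_mxEd !mxE mulr1.
Qed.

Lemma centered_gram_dr j l :
  centered_gram (rshift 1 j) (rshift 1 l) =
    \sum_i (delta i)%:R * (centered j (z i) * centered l (z i)).
Proof.
rewrite summxE; apply: eq_bigr => i _.
by rewrite mxE mxE big_ord1 [X in _ * (_ * X)]mxE !col_mxEd !mxE.
Qed.

Lemma sqr_centered_le i j : centered j (z i) ^+ 2 <= half_range j ^+ 2.
Proof.
have le_max : z i j 0 <= zmax z j by apply: (le_bigmax _ (fun i => z i j 0)).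
have ge_min : zmin z j <= z i j 0 by apply: (bigmin_le _ i (fun i => z i j 0)).
(* The difference of the two squares is [(zmax z j - z i j 0) * (z i j 0 - zmin z j)]. *)
rewrite /centered /midrange /half_range; nra.
Qed.

Lemma psd_centered_gram : psd centered_gram.
Proof. by apply: psd_gram => i; apply: ler0n. Qed.

Lemma det_centered_gram_le :
  \det centered_gram <= size_delta * \prod_j (size_delta * half_range j ^+ 2).
Proof.
apply: le_trans (hadamard_psd psd_centered_gram) _.
rewrite big_split_ord /= big_ord1 centered_gram_ul.
have size_ge0 : 0 <= size_delta by apply: sumr_ge0 => i _; apply: ler0n.
apply: ler_wpM2l => //; apply: ler_prod => j _.
rewrite psd_diag_ge0 /=; last exact: psd_centered_gram.
rewrite centered_gram_dr mulr_suml; apply: ler_sum => i _.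
by rewrite ler_wpM2l ?ler0n // -expr2 sqr_centered_le.
Qed.

(** * Equality for subdata balanced on the corners *)

Section Balanced.
Hypothesis bal : balanced_on_corners z delta.

(* Double counting the pairs of selected points that [phi] maps to each other:
   with [c] points at each corner, it gives [c * S = - (c * S)]. *)
Lemma balanced_sum_eq0 (phi : 'cV[R]_p -> 'cV[R]_p) (f : 'cV[R]_p -> R) :
  involutive phi -> (forall a, is_corner z a -> is_corner z (phi a)) ->
  (forall a, f (phi a) = - f a) ->
  \sum_i (delta i)%:R * f (z i) = 0.
Proof.
move=> phiK phi_corner f_phi; have [on_corner same_count] := bal.
have [/existsP[i0 di0]|/existsPn no_delta] := boolP [exists i, delta i]; last first.
  by rewrite big1 // => i _; rewrite (negPf (no_delta i)) mul0r.
pose c : R := (subdata_count z delta (z i0))%:R.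
set S := \sum_i _.
have c_gt0 : 0 < c.
  by rewrite ltr0n; apply/card_gt0P; exists i0; rewrite inE di0 eqxx.
have countE a : is_corner z a -> \sum_i (delta i)%:R * (z i == a)%:R = c.
  move=> a_corner; rewrite /c (same_count _ a) //; last exact: on_corner.
  rewrite /subdata_count -sum1_card natr_sum [RHS]big_mkcond /=.
  apply: eq_bigr => i _; rewrite inE -natrM mulnb.
  by case: (_ && _).
(* For each selected [i], the factor [c] is expanded as the number of selected [l] with [z l] at the
   corner [phi (z i)]. *)
have cS (g : 'cV[R]_p -> R) :
    c * (\sum_i (delta i)%:R * g (z i)) =
    \sum_i \sum_l (delta i)%:R * (delta l)%:R * (z l == phi (z i))%:R * g (z i).
  rewrite mulr_sumr; apply: eq_bigr => i _.
  have [di|_] := boolP (delta i); last first.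
    by rewrite mul0r mulr0 big1 // => l _; rewrite !mul0r.
  rewrite -(countE (phi (z i))); last exact/phi_corner/on_corner.
  by rewrite mul1r mulr_suml; apply: eq_bigr => l _; rewrite mul1r.
have : c * S = - (c * S).
  (* The pairing is symmetric because [phi] is an involution, so exchanging [i] and [l] changes only
     the sign of [f]. *)
  rewrite /S (cS f) [LHS]exchange_big -sumrN; apply: eq_bigr => i _.
  rewrite -sumrN; apply: eq_bigr => l _.
  have -> : (z i == phi (z l)) = (z l == phi (z i)).
    by rewrite eq_sym (can2_eq phiK phiK).
  have [->|_] := eqVneq (z l) (phi (z i)); last by rewrite !mulr0 !mul0r oppr0.
  by rewrite f_phi mulrN [_ * (delta l)%:R]mulrC.
move=> cS_eq; have /eqP : c * S = 0 by lra.
by rewrite mulf_eq0 gt_eqF //= => /eqP.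
Qed.

(** The affine formula swaps the two extremes of covariate [j] on corners, is an involution on all
    vectors, and also covers a constant covariate. *)
Definition reflect_coord (j : 'I_p) (a : 'cV[R]_p) : 'cV[R]_p :=
  \col_l if l == j then zmax z j + zmin z j - a j 0 else a l 0.

Lemma reflect_coordK j : involutive (reflect_coord j).
Proof.
move=> a; apply/colP => l; rewrite !mxE eqxx.
by case: eqP => // ->; rewrite opprB addrC subrK.
Qed.

Lemma reflect_coord_corner j a :
  is_corner z a -> is_corner z (reflect_coord j a).
Proof.
move=> a_corner l; rewrite mxE; case: eqP => // ->.
by case: (a_corner j) => ->; [right|left]; ring.
Qed.

Lemma centered_reflect_coord j l a :
  centered l (reflect_coord j a) =
    if l == j then - centered l a else centered l a.
Proof.
rewrite /centered mxE; case: eqP => // ->.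
by rewrite /midrange; field.
Qed.

Lemma balanced_sum_centered_eq0 j :
  \sum_i (delta i)%:R * centered j (z i) = 0.
Proof.
apply: (balanced_sum_eq0 (@reflect_coordK j) (@reflect_coord_corner j)) => a.
by rewrite centered_reflect_coord eqxx.
Qed.

Lemma balanced_sum_centeredM_eq0 j l : j != l ->
  \sum_i (delta i)%:R * (centered j (z i) * centered l (z i)) = 0.
Proof.
move=> jl.
apply: (@balanced_sum_eq0 (reflect_coord j)
  (fun a => centered j a * centered l a)) => [||a].
- exact: reflect_coordK.
- exact: reflect_coord_corner.
- by rewrite !centered_reflect_coord eqxx eq_sym (negPf jl) mulNr.
Qed.

(** At a corner every centered coordinate is plus or minus the half range. *)
Lemma balanced_sum_sqr_centered j :
  \sum_i (delta i)%:R * (centered j (z i) * centered j (z i)) =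
    size_delta * half_range j ^+ 2.
Proof.
rewrite mulr_suml; apply: eq_bigr => i _.
have [di|_] := boolP (delta i); last by rewrite !mul0r.
congr (_ * _); rewrite /centered /midrange /half_range.
by case: (bal.1 i di j) => ->; field.
Qed.

Lemma det_centered_gram_balanced :
  \det centered_gram = size_delta * \prod_j (size_delta * half_range j ^+ 2).
Proof.
rewrite det_trig; last first.
  (* Symmetry moves an entry above the diagonal to its mirror image below, where [centered_gram_dl]
     or [centered_gram_dr] computes it. *)
  apply/is_trig_mxP => i j; rewrite -(psd_centered_gram.1) mxE.
  case: (splitP j) => [j0 ->|j1 jE]; first by rewrite ord1.
  have -> : j = rshift 1 j1 by apply: val_inj.
  case: (splitP i) => [i0 iE _|i1 iE].
    have -> : i = lshift p 0 by apply: val_inj; rewrite /= iE ord1.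
    by rewrite centered_gram_dl balanced_sum_centered_eq0.
  have -> : i = rshift 1 i1 by apply: val_inj.
  rewrite /= ltn_add2l => ij; rewrite centered_gram_dr.
  by rewrite balanced_sum_centeredM_eq0 // neq_ltn ij orbT.
rewrite big_split_ord /= big_ord1 centered_gram_ul; congr (_ * _).
by apply: eq_bigr => j _; rewrite centered_gram_dr balanced_sum_sqr_centered.
Qed.

End Balanced.
End CenteredInformation.

(** * The bound and its equality case in terms of [k], [sigma] and the ranges *)

Theorem theorem2 (R : realType) (n p k : nat) (z : 'I_n.+1 -> 'cV[R]_p)
    (sigma : R) (hsigma : 0 < sigma ^+ 2)
    (delta : 'I_n.+1 -> bool) (hk : (\sum_i (delta i : nat))%N = k) :
  \det (info_mx sigma z delta) <=
    k%:R ^+ (p + 1) / (4%:R ^+ p * sigma ^+ (2 * (p + 1)))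
      * \prod_(j < p) (zmax z j - zmin z j) ^+ 2
  /\ (balanced_on_corners z delta ->
      \det (info_mx sigma z delta) =
        k%:R ^+ (p + 1) / (4%:R ^+ p * sigma ^+ (2 * (p + 1)))
          * \prod_(j < p) (zmax z j - zmin z j) ^+ 2).
Proof.
have -> : k%:R ^+ (p + 1) / (4%:R ^+ p * sigma ^+ (2 * (p + 1)))
      * \prod_(j < p) (zmax z j - zmin z j) ^+ 2 =
    (sigma ^+ 2)^-1 ^+ (1 + p) *
      ((\sum_i (delta i)%:R) *
       \prod_j ((\sum_i (delta i)%:R) * half_range z j ^+ 2)).
  (* Squaring the half ranges yields the [4 ^+ p]; the constant regressor supplies the extra factor
     [k]. *)
  have prodE c : \prod_(j < p) (c * half_range z j ^+ 2) =
      (c / 4) ^+ p * \prod_(j < p) (zmax z j - zmin z j) ^+ 2.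
    rewrite -[X in _ ^+ X]card_ord -prodr_const -big_split /=.
    by apply: eq_bigr => j _; rewrite /half_range; field.
  rewrite -natr_sum hk prodE exprM [(p + 1)%N]addnC !(exprD _ 1 p) !expr1.
  rewrite expr_div_n exprVn.
  have sigma_neq0 : sigma != 0 by rewrite -sqrf_eq0 gt_eqF.
  by field; rewrite !expf_neq0 ?pnatr_eq0.
rewrite det_info_mx; split=> [|bal].
  apply: ler_wpM2l; last exact: det_centered_gram_le.
  by rewrite exprn_ge0 // invr_ge0 ltW.
by rewrite det_centered_gram_balanced.
Qed.
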